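(* For every integer $n \geq 7$, $\mathrm{sat}(n,K_3,K_4) = n-2$. Furthermore, up to isomorphism, the only $n$-vertex $K_4$-saturated graph with exactly $n-2$ triangles is the join of an edge $K_2$ and an independent set with $n-2$ vertices.
   Context: All graphs are finite and simple. A graph $G$ is $F$-free if it contains no (not necessarily induced) subgraph isomorphic to $F$. $G$ is $F$-saturated if $G$ is $F$-free but adding any nonedge to $G$ creates at least one copy of $F$. A copy of $H$ in $G$ is a (not necessarily induced) subgraph of $G$ isomorphic to $H$. $\mathrm{sat}(n,H,F)$ denotes the minimum number of copies of $H$ in an $n$-vertex $F$-saturated graph. $K_m$ is the complete graph on $m$ vertices. The join of two graphs is obtained from their disjoint union by joining every vertex of the first to every vertex of the second. *)

(* Defs.v *)
From HB Require Import structures.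
From mathcomp Require Import all_boot.

Set Implicit Arguments.
Unset Strict Implicit.
Unset Printing Implicit Defensive.

Record sgraph := SGraph {
  vertex :> finType;
  adj : rel vertex;
  adj_sym : symmetric adj;
  adj_irr : irreflexive adj }.

Definition giso (G H : sgraph) : bool :=
  [exists f : {ffun G -> H},
    [&& injectiveb f, [forall y, y \in codom f] &
        [forall x, forall y, adj (f x) (f y) == adj x y]]].

Lemma gisoP (G H : sgraph) :
  reflect (exists f : G -> H, bijective f /\ {mono f : x y / adj x y})
          (giso G H).
Proof.
apply: (iffP existsP) => [[f /and3P[/injectiveP injf /forallP surjf /forallP mf]]|].
  exists f; split; last by move=> x y; apply/eqP/(forallP (mf x)).
  exists (fun y => iinv (surjf y)) => [x|y]; last exact: f_iinv.
  by apply: injf; rewrite f_iinv.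
case=> f [[g fK gK] mf]; exists [ffun x => f x]; apply/and3P; split.
- by apply/injectiveP => x y; rewrite !ffunE; apply: (can_inj fK).
- by apply/forallP => y; apply/codomP; exists (g y); rewrite ffunE gK.
- by apply/forallP => x; apply/forallP => y; rewrite !ffunE mf.
Qed.

Definition edges (G : sgraph) : {set {set G}} :=
  [set [set p.1; p.2] | p : G * G & adj p.1 p.2].

(* A subgraph is given by its vertex set S.1 and its edge set S.2. *)
Definition is_subgraph (G : sgraph) (S : {set G} * {set {set G}}) : bool :=
  (S.2 \subset edges G) && [forall e in S.2, e \subset S.1].

Section SubgraphGraph.
Variables (G : sgraph) (S : {set G} * {set {set G}}).

(* The condition x != y is automatic when S is a subgraph. *)
Definition subgraph_adj : rel {x : G | x \in S.1} :=
  fun x y => (x != y) && ([set val x; val y] \in S.2).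

Fact subgraph_adj_sym : symmetric subgraph_adj.
Proof. by move=> x y; rewrite /subgraph_adj eq_sym setUC. Qed.

Fact subgraph_adj_irr : irreflexive subgraph_adj.
Proof. by move=> x; rewrite /subgraph_adj eqxx. Qed.

Definition subgraph_graph : sgraph := SGraph subgraph_adj_sym subgraph_adj_irr.
End SubgraphGraph.

Definition copies (H G : sgraph) : {set {set G} * {set {set G}}} :=
  [set S | is_subgraph S && giso (subgraph_graph S) H].

Definition free (F G : sgraph) : bool := copies F G == set0.

Section AddEdge.
Variables (G : sgraph) (x y : G).

Definition add_edge_adj : rel G :=
  fun u v => adj u v || (u != v) && ([set u; v] == [set x; y]).

Fact add_edge_adj_sym : symmetric add_edge_adj.
Proof. by move=> u v; rewrite /add_edge_adj adj_sym eq_sym setUC. Qed.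

Fact add_edge_adj_irr : irreflexive add_edge_adj.
Proof. by move=> u; rewrite /add_edge_adj adj_irr eqxx. Qed.

Definition add_edge : sgraph := SGraph add_edge_adj_sym add_edge_adj_irr.
End AddEdge.

Definition saturated (F G : sgraph) : Prop :=
  free F G /\ forall x y : G, x != y -> ~~ adj x y -> ~~ free F (add_edge x y).

(* sat(n, H, F) = m: the minimum exists and equals m. *)
Definition is_sat (n : nat) (H F : sgraph) (m : nat) : Prop :=
  (exists G : sgraph, [/\ #|G| = n, saturated F G & #|copies H G| = m]) /\
  (forall G : sgraph, #|G| = n -> saturated F G -> m <= #|copies H G|).

Fact complete_adj_sym m : symmetric (fun x y : 'I_m => x != y).
Proof. by move=> x y; rewrite eq_sym. Qed.

Fact complete_adj_irr m : irreflexive (fun x y : 'I_m => x != y).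
Proof. by move=> x; rewrite eqxx. Qed.

Definition complete_graph (m : nat) : sgraph :=
  SGraph (@complete_adj_sym m) (@complete_adj_irr m).

Definition edgeless_graph (m : nat) : sgraph :=
  @SGraph 'I_m (fun _ _ => false) (fun _ _ => erefl) (fun _ => erefl).

Section Join.
Variables G H : sgraph.

Definition join_adj : rel (G + H)%type := fun u v =>
  match u, v with
  | inl x, inl y => adj x y
  | inr x, inr y => adj x y
  | _, _ => true
  end.

Fact join_adj_sym : symmetric join_adj.
Proof. by move=> [x|x] [y|y] //=; apply: adj_sym. Qed.

Fact join_adj_irr : irreflexive join_adj.
Proof. by move=> [x|x] /=; apply: adj_irr. Qed.

Definition join_graph : sgraph := SGraph join_adj_sym join_adj_irr.
End Join.

(* Main.v *)
Require Import Defs.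
From mathcomp Require Import all_boot.
From mathcomp Require Import zify.

Set Implicit Arguments.
Unset Strict Implicit.
Unset Printing Implicit Defensive.

(** Copies of a complete graph are the same thing as cliques, so everything is
    about the set of triangles of a graph G on n vertices in which no K_4 occurs
    and any two distinct nonadjacent vertices x, y have a common edge: an edge
    uw with both ends adjacent to x and to y.  Write t for the number of
    triangles, t(v) for the number of those through v, and N for the
    neighbourhood of v.  Every t(v) is positive, and a vertex with the smallest
    t(v) decides between the book (the join of K_2 and an independent set),
    which has n - 2 triangles, and the bound t >= n - 1.

    If every t(v) is at least 3, double counting gives 3t >= 3n.

    The key observation ([common_triangle_vertex_dominating]) is that if all
    triangles through v share a second vertex b, then b is adjacent to every
    other vertex.  A vertex outside N has a common edge with v, which forms a
    triangle with v and so contains b; and a neighbour x of v missed by b would,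
    through its common edge with the third vertex a of a triangle vab, give a
    K_4 containing a and b.

    If t(v) = 1, with triangle vab, then a and b are both dominating, so the
    remaining vertices are independent and G is a book ([triangles_at1_book]).

    Suppose now that every t(v) is at least 2 and that some vertex v lies in
    exactly two triangles A and B.  If they share a second vertex b, then b is
    dominating, so b lies in all triangles, and 3t is t(b) = t plus at least
    2(n - 1) ([dominating_triangles]).  If they meet only in v, each vertex
    x of N is the only vertex of N in some triangle, and each vertex y outside
    N and different from v is the only vertex outside N in some triangle.  A
    triangle cannot play both parts, so t >= n - 1
    ([almost_disjoint_triangles]). *)

(** * Copies of complete graphs as cliques *)

Definition cliques (m : nat) (G : sgraph) : {set {set G}} :=
  [set S : {set G} | (#|S| == m) &&
     [forall x in S, forall y in S, (x != y) ==> adj x y]].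

Lemma cliquesP (m : nat) (G : sgraph) (S : {set G}) :
  reflect (#|S| = m /\ {in S &, forall x y, x != y -> adj x y})
          (S \in cliques m G).
Proof.
rewrite inE; apply: (iffP andP) => [[/eqP cS /forall_inP h]|[cS h]].
  by split=> // x y xS yS; apply/implyP; move/forall_inP: (h x xS); apply.
split; first exact/eqP.
by apply/forall_inP => x xS; apply/forall_inP => y yS; apply/implyP/h.
Qed.

Lemma adj_neq (G : sgraph) (x y : G) : adj x y -> x != y.
Proof. by apply: contraTneq => ->; rewrite adj_irr. Qed.

Lemma mem_edges (G : sgraph) (x y : G) : ([set x; y] \in edges G) = adj x y.
Proof.
apply/imsetP/idP => [[[u w] + exy]|xy]; last first.
  by exists (x, y); rewrite ?inE.
rewrite inE /= in exy * => uw; have nuw := adj_neq uw.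
have /set2P ux : u \in [set x; y] by rewrite exy set21.
have /set2P wx : w \in [set x; y] by rewrite exy set22.
case: ux wx nuw uw => -> [->|->] //; rewrite ?eqxx // => _.
by rewrite adj_sym.
Qed.

Lemma edgesP (G : sgraph) (e : {set G}) :
  e \in edges G -> exists x y, e = [set x; y] /\ adj x y.
Proof. by case/imsetP => -[x y]; rewrite inE /= => xy ->; exists x, y. Qed.

(** A copy of K_m carries all edges of G inside its vertex set, hence is
    determined by that set. *)
Lemma copies_completeE (m : nat) (G : sgraph) :
  copies (complete_graph m) G =
  [set (S, [set e in edges G | e \subset S]) | S : {set G} in cliques m G].
Proof.
apply/setP => -[V E]; rewrite inE; apply/andP/imsetP => /=.
- case=> /andP[/= /subsetP sE /forall_inP EV] /gisoP[f [bf mf]].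
  have VE x y : x \in V -> y \in V -> x != y -> [set x; y] \in E.
    move=> xV yV nxy; have := mf (exist _ x xV) (exist _ y yV).
    rewrite /= (inj_eq (bij_inj bf)) /subgraph_adj /= -val_eqE /= nxy /=.
    by move=> <-.
  exists V.
    apply/cliquesP; split=> [|x y xV yV nxy].
      by have := bij_eq_card bf; rewrite card_sig card_ord.
    by rewrite -mem_edges; apply/sE/VE.
  congr (_, _); apply/setP => e; rewrite inE; apply/idP/andP => [eE|].
    by split; [apply: sE | apply: EV].
  case=> /edgesP[x [y [-> xy]]]; rewrite subUset !sub1set => /andP[xV yV].
  by apply: VE; rewrite ?adj_neq.
- case=> S /cliquesP[cS kS] [-> ->]; split.
    apply/andP; split; first by apply/subsetP => e; rewrite inE => /andP[].
    by apply/forall_inP => e; rewrite inE => /andP[].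
  have cV : #|{: {x : G | x \in S}}| = m by rewrite card_sig.
  apply/gisoP; exists (fun x => cast_ord cV (enum_rank x)); split.
    exists (fun i => enum_val (cast_ord (esym cV) i)) => x.
      by rewrite cast_ordK enum_rankK.
    by rewrite enum_valK cast_ordKV.
  move=> x y; rewrite /= (inj_eq (@cast_ord_inj _ _ _)) (inj_eq enum_rank_inj).
  rewrite /subgraph_adj; case: (eqVneq x y) => //= nxy.
  rewrite inE mem_edges subUset !sub1set !(valP x, valP y) !andbT.
  by apply/esym/kS; rewrite ?(valP x, valP y).
Qed.

Lemma card_copies_complete (m : nat) (G : sgraph) :
  #|copies (complete_graph m) G| = #|cliques m G|.
Proof. by rewrite copies_completeE card_imset // => S S' [->]. Qed.

Lemma free_completeE (m : nat) (G : sgraph) :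
  free (complete_graph m) G = (cliques m G == set0).
Proof. by rewrite /free -!cards_eq0 card_copies_complete. Qed.

Lemma clique3P (G : sgraph) (a b c : G) :
  reflect [/\ adj a b, adj a c & adj b c] ([set a; b; c] \in cliques 3 G).
Proof.
apply: (iffP (cliquesP 3 _)) => [[c3 k]|[ab ac bc]].
  move: c3; rewrite setUC cardsU1 cards2 !inE negb_or.
  rewrite ![c == _]eq_sym.
  have [_|nab] := eqVneq a b; first by case: (_ && _).
  have [//|nac /=] := eqVneq a c; have [//|nbc _] := eqVneq b c.
  by split; apply: k => //; rewrite !inE eqxx ?orbT.
split.
  by rewrite setUC cardsU1 cards2 !inE negb_or ![c == _]eq_sym !adj_neq.
move=> x y; rewrite !inE -!orbA => /or3P[] /eqP-> /or3P[] /eqP->;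
  by rewrite ?eqxx // adj_sym.
Qed.

Lemma clique3_mem (G : sgraph) (S : {set G}) (v : G) :
  S \in cliques 3 G -> v \in S ->
  exists a b, [/\ S = [set v; a; b], adj v a, adj v b & adj a b].
Proof.
move=> S3 vS; have /cliquesP[cS _] := S3.
have /cards2P[a [b [_ Sab]]] : #|S :\ v| == 2.
  by move: cS; rewrite (cardsD1 v S) vS add1n => -[->].
have eS : S = [set v; a; b] by rewrite -(setD1K vS) Sab setUA.
by exists a, b; move: S3; rewrite eS => /clique3P[].
Qed.

Lemma clique_extend (m : nat) (G : sgraph) (S : {set G}) (x : G) :
  S \in cliques m G -> (forall y, y \in S -> adj x y) -> x |: S \in cliques m.+1 G.
Proof.
move=> /cliquesP[cS kS] xS; apply/cliquesP; split.
  rewrite cardsU1 cS; case: (boolP (x \in S)) => // /xS.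
  by rewrite adj_irr.
move=> u w /setU1P[->|uS] /setU1P[->|wS]; rewrite ?eqxx //.
- by move=> _; apply: xS.
- by move=> _; rewrite adj_sym xS.
- exact: kS.
Qed.

(** * K_4-saturation in terms of triangles and common edges *)

Definition common_edge (G : sgraph) (x y : G) : Prop :=
  exists u w, [/\ adj u w, adj x u, adj x w, adj y u & adj y w].

(** The first clause is K_4-freeness, phrased as: no vertex is adjacent to all
    vertices of a triangle.  This is how a forbidden K_4 shows up below, as a
    triangle together with one more vertex. *)
Definition K4_saturated (G : sgraph) : Prop :=
  (forall S, S \in cliques 3 G -> forall x, exists2 y, y \in S & ~~ adj x y) /\
  (forall x y : G, x != y -> ~~ adj x y -> common_edge x y).

Lemma free_K4P (G : sgraph) :
  free (complete_graph 4) G <->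
  (forall S, S \in cliques 3 G -> forall x, exists2 y, y \in S & ~~ adj x y).
Proof.
rewrite free_completeE; split=> [/eqP k4 S S3 x|h].
  apply/exists_inP; rewrite -negb_forall_in; apply/negP => /forall_inP xS.
  by have := clique_extend S3 xS; rewrite k4 inE.
apply/eqP/setP => Q; rewrite [RHS]inE; apply/negP => /cliquesP[cQ kQ].
have /card_gt0P[x xQ] : 0 < #|Q| by rewrite cQ.
have [|y] := h (Q :\ x) _ x.
  apply/cliquesP; split; first by move: cQ; rewrite (cardsD1 x) xQ add1n => -[].
  by move=> u w /setD1P[_ uQ] /setD1P[_ wQ]; apply: kQ.
by case/setD1P => nyx yQ /negP; apply; apply: kQ; rewrite // eq_sym.
Qed.

Lemma not_free_add_edgeP (G : sgraph) (x y : G) :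
  free (complete_graph 4) G -> x != y ->
  ~~ free (complete_graph 4) (add_edge x y) <-> common_edge x y.
Proof.
rewrite !free_completeE => /eqP k4 nxy; split.
- case/set0Pn => Q /cliquesP[cQ kQ].
  have adjQ (u w : G) : u \in Q -> w \in Q -> u != w ->
      [set u; w] != [set x; y] -> adj u w.
    by move=> uQ wQ nuw /negPf n2; have := kQ u w uQ wQ nuw;
      rewrite /= /add_edge_adj n2 andbF orbF.
  (* A new 4-clique must use the new edge, both of whose ends it contains. *)
  have [xyQ|xyQ] := boolP ([set x; y] \subset Q); last first.
    suff: Q \in cliques 4 G by rewrite k4 inE.
    apply/cliquesP; split=> // u w uQ wQ nuw; apply: adjQ => //.
    by apply: contraNneq xyQ => <-; rewrite subUset !sub1set uQ.
  have /cards2P[u [w [nuw Duw]]] : #|Q :\: [set x; y]| == 2.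
    by rewrite cardsD (setIidPr xyQ) cQ cards2 nxy.
  have /setDP[uQ nu] : u \in Q :\: [set x; y] by rewrite Duw set21.
  have /setDP[wQ nw] : w \in Q :\: [set x; y] by rewrite Duw set22.
  move: xyQ; rewrite subUset !sub1set => /andP[xQ yQ].
  have join (p q : G) : p \in [set x; y] -> q \in Q -> q \notin [set x; y] -> adj p q.
    move=> pxy qQ nq; apply: adjQ => //; first by case/set2P: pxy => ->.
      by apply: contraNneq nq => <-.
    by apply: contraNneq nq => <-; rewrite set22.
  exists u, w; split; try by apply: join; rewrite // ?set21 ?set22.
  by apply: adjQ => //; apply: contraNneq nu => <-; rewrite set21.
- case=> u [w [uw xu xw yu yw]]; apply/set0Pn.
  have sub (p q : G) : adj p q -> @adj (add_edge x y) p q.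
    by move=> pq; rewrite /= /add_edge_adj pq.
  have new : @adj (add_edge x y) x y by rewrite /= /add_edge_adj nxy eqxx orbT.
  have k3 : ([set x; u; w] : {set add_edge x y}) \in cliques 3 (add_edge x y).
    by apply/clique3P; split; apply: sub.
  apply/set0Pn; rewrite -free_completeE; apply/negP => /free_K4P /(_ _ k3 y)[z].
  rewrite !inE -orbA => /or3P[] /eqP-> /negP; apply.
  + by rewrite adj_sym.
  + exact: sub.
  + exact: sub.
Qed.

Lemma saturated_K4P (G : sgraph) :
  saturated (complete_graph 4) G <-> K4_saturated G.
Proof.
split=> [[f h]|[k4 h]].
  by split=> [|x y nxy xy]; [apply/free_K4P | apply/not_free_add_edgeP/h].
have f : free (complete_graph 4) G by apply/free_K4P.
by split=> // x y nxy xy; apply/not_free_add_edgeP => //; apply: h.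
Qed.

(** * Triangles through a vertex *)

Definition triangles_at (G : sgraph) (v : G) : {set {set G}} :=
  [set S in cliques 3 G | v \in S].

Lemma mem_triangles_at (G : sgraph) (v a b : G) :
  adj v a -> adj v b -> adj a b -> [set v; a; b] \in triangles_at v.
Proof.
by move=> va vb ab; rewrite inE !in_setU set11 andbT; apply/clique3P.
Qed.

Lemma sum_triangles_at (G : sgraph) :
  \sum_(v : G) #|triangles_at v| = 3 * #|cliques 3 G|.
Proof.
transitivity (\sum_(v : G) \sum_(S in cliques 3 G) (v \in S : nat)).
  apply: eq_bigr => v _; rewrite -sum1_card -big_mkcondr.
  by apply: eq_bigl => S; rewrite inE.
rewrite exchange_big /= mulnC -sum_nat_const; apply: eq_bigr => S /cliquesP[<- _].
by rewrite -big_mkcond sum1_card.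
Qed.

Definition dominating (G : sgraph) (b : G) : Prop := forall x, x != b -> adj b x.

(** A nonneighbour of v yields a common edge, hence a triangle at v.  If v is
    dominating, any edge avoiding v does, and two further vertices produce one:
    either they are adjacent or their common edge has an end other than v. *)
Lemma triangles_at_gt0 (G : sgraph) (v : G) :
  K4_saturated G -> 2 < #|G| -> 0 < #|triangles_at v|.
Proof.
move=> [_ sat] G3.
have tri a b : adj v a -> adj v b -> adj a b -> 0 < #|triangles_at v|.
  move=> va vb ab; apply/card_gt0P; exists [set v; a; b].
  exact: mem_triangles_at.
have [/forall_inP dom|] := boolP [forall x in predC1 v, adj v x]; last first.
  rewrite negb_forall_in => /exists_inP[x nxv nvx].
  have [|u [w [uw vu vw _ _]]] := sat v x _ nvx; first by rewrite eq_sym.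
  exact: tri uw.
have /card_gt1P[x [y [xv yv nxy]]] : 1 < #|[set~ v]|.
  by rewrite cardsC1; lia.
move: xv yv; rewrite !inE => xv yv.
have [xy|nxy'] := boolP (adj x y); first by apply: tri xy; apply: dom.
have [u [w [uw xu xw _ _]]] := sat x y nxy nxy'.
have [uv|nuv] := eqVneq u v; last by apply: tri xu; apply: dom.
by apply: tri xw; apply: dom => //; apply: contraTneq uw => ->; rewrite uv adj_irr.
Qed.

(** An edge inside the neighbourhood of v must meet b.  The common edge of v and
    a vertex x outside the neighbourhood is such an edge, so b is adjacent to x.
    If instead x is a neighbour of v but not of b, let vab be a triangle.  The
    vertices a and x are not adjacent, and the common edge uw of a and x has
    both ends outside the neighbourhood of v, since x has no neighbour inside.
    Hence b is adjacent to u and w, and abuw is a K_4. *)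
Lemma common_triangle_vertex_dominating (G : sgraph) (v b : G) :
  K4_saturated G -> v != b -> triangles_at v != set0 ->
  (forall S, S \in triangles_at v -> b \in S) -> dominating b.
Proof.
move=> [k4 sat] nvb /set0Pn[S Sv] hb.
(* The link of v: its edges correspond to the triangles at v. *)
have link u w : adj v u -> adj v w -> adj u w -> (b == u) || (b == w).
  move=> vu vw uw; have := hb _ (mem_triangles_at vu vw uw).
  by rewrite !in_setU !in_set1 (eq_sym b v) (negPf nvb).
have nonnb x : x != v -> ~~ adj v x -> adj b x.
  rewrite eq_sym => nxv vx; have [u [w [uw vu vw xu xw]]] := sat v x nxv vx.
  by rewrite adj_sym; case/orP: (link u w vu vw uw) => /eqP->.
have [a [vb va ab]] : exists a, [/\ adj v b, adj v a & adj a b].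
  have bS := hb S Sv; move: Sv; rewrite inE => /andP[S3 vS].
  have [p [q [eS vp vq pq]]] := clique3_mem S3 vS.
  move: bS; rewrite eS !inE eq_sym (negPf nvb) /= => /orP[] /eqP->.
    by exists q; split; rewrite // adj_sym.
  by exists p.
move=> x nxb; have [vx|vx] := boolP (adj v x); last first.
  by have [->|nxv] := eqVneq x v; [rewrite adj_sym | apply: nonnb].
apply: contraT => bx.
have ax : ~~ adj a x.
  apply/negP => ax; case/orP: (link a x va vx ax) => /eqP e.
    by move: ab; rewrite e adj_irr.
  by rewrite e eqxx in nxb.
have nax : a != x by apply: contraNneq bx => <-; rewrite adj_sym.
have [u [w [uw au aw xu xw]]] := sat a x nax ax.
have out z : adj x z -> ~~ adj v z.
  move=> xz; apply/negP => vz; case/orP: (link x z vx vz xz) => /eqP e.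
    by rewrite e eqxx in nxb.
  by move: bx; rewrite e adj_sym xz.
have bz z z' : adj z z' -> adj x z -> adj x z' -> adj b z.
  move=> zz xz xz'; apply: nonnb; last exact: out.
  by apply: contraTneq zz => ->; apply: out.
have bu := bz u w uw xu xw; have bw : adj b w by apply: bz (xw) (xu); rewrite adj_sym.
have /clique3P k := And3 au aw uw.
have [y] := k4 _ k b; rewrite !inE -orbA => /or3P[] /eqP->; rewrite ?bu ?bw //.
by rewrite adj_sym ab.
Qed.

(** A triangle avoiding b would extend to a K_4, so t(b) is the total number t
    of triangles and summing t(v) over all vertices gives 3t >= t + 2(n - 1). *)
Lemma dominating_triangles (G : sgraph) (b : G) :
  K4_saturated G -> dominating b -> (forall v : G, 1 < #|triangles_at v|) ->
  #|G|.-1 <= #|cliques 3 G|.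
Proof.
move=> [k4 _] dom t2.
have tb : #|triangles_at b| = #|cliques 3 G|.
  apply: eq_card => S; rewrite inE; case: (boolP (S \in _)) => //= S3.
  have [y yS nby] := k4 S S3 b.
  by have [<-|/dom] := eqVneq y b; [| rewrite (negPf nby)].
have := sum_triangles_at G; rewrite (bigD1 b) //= tb.
have : \sum_(v | v != b) 2 <= \sum_(v | v != b) #|triangles_at v|.
  by apply: leq_sum => v _; apply: t2.
rewrite sum_nat_const cardC1.
move: (\sum_(_ | _) _) #|cliques 3 G| #|G|.-1 => A B n; lia.
Qed.

(** A triangle has three vertices, so it cannot have exactly one vertex in N and
    exactly one vertex outside N.  The two families of triangles supplied by the
    hypotheses are thus disjoint, and in each of them the trace on N, or on its
    complement, recovers the vertex. *)
Lemma isolating_triangles (G : sgraph) (N M : {set G}) :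
  (forall x, x \in N -> exists2 S, S \in cliques 3 G & S :&: N = [set x]) ->
  (forall y, y \in M -> exists2 S, S \in cliques 3 G & S :\: N = [set y]) ->
  #|N| + #|M| <= #|cliques 3 G|.
Proof.
move=> hN hM.
pose A := [set S in cliques 3 G | #|S :&: N| == 1].
rewrite -(cardsID A (cliques 3 G)); apply: leq_add.
  rewrite -(card_imset _ (@set1_inj G)).
  apply: leq_trans (leq_imset_card (fun S => S :&: N) _).
  apply/subset_leq_card/subsetP => _ /imsetP[x xN ->].
  have [S S3 SN] := hN x xN; apply/imsetP; exists S => //.
  by rewrite !inE in S3 *; rewrite S3 SN cards1.
rewrite -(card_imset _ (@set1_inj G)).
apply: leq_trans (leq_imset_card (fun S => S :\: N) _).
apply/subset_leq_card/subsetP => _ /imsetP[x xM ->].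
have [S S3 SN] := hM x xM; apply/imsetP; exists S => //.
rewrite inE S3 andbT inE S3 /=; have /cliquesP[cS _] := S3.
by move: (cardsID N S); rewrite SN cards1 cS; lia.
Qed.

(** Let N be the neighbourhood of v.  For y outside N and distinct from v, the
    common edge of v and y lies in N and forms with y a triangle whose only
    vertex outside N is y.  For x in N, take a neighbour y of v in one of A, B
    that does not contain x.  As A and B meet only in v, the vertices x and y
    are not adjacent and have no common neighbour in N, so their common edge
    forms with x a triangle whose only vertex in N is x. *)
Lemma almost_disjoint_triangles (G : sgraph) (v : G) (A B : {set G}) :
  K4_saturated G -> triangles_at v = [set A; B] -> A :&: B = [set v] ->
  #|G|.-1 <= #|cliques 3 G|.
Proof.
move=> [_ sat] eT AB; pose N := [set x | adj v x].
have tri x y : adj v x -> adj v y -> adj x y ->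
    (x \in A) && (y \in A) || (x \in B) && (y \in B).
  move=> vx vy xy; have := mem_triangles_at vx vy xy.
  by rewrite eT => /set2P[] <-; rewrite !inE !eqxx !orbT.
have AB0 x : x != v -> x \in A -> x \in B -> False.
  move=> nxv xA xB; have : x \in A :&: B by rewrite inE xA.
  by rewrite AB inE (negPf nxv).
have nv x : adj v x -> x != v by move/adj_neq; rewrite eq_sym.
have nbr C : C \in triangles_at v -> exists2 y, y \in C & adj v y.
  rewrite inE => /andP[C3 vC]; have [y [z [-> vy _ _]]] := clique3_mem C3 vC.
  by exists y; rewrite // !inE eqxx orbT.
have [yA yAA vyA] : exists2 y, y \in A & adj v y by apply: nbr; rewrite eT set21.
have [yB yBB vyB] : exists2 y, y \in B & adj v y by apply: nbr; rewrite eT set22.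
(* If x is in A then y is taken in B, and otherwise in A. *)
have far x : adj v x -> exists y, [/\ y != x, adj v y, ~~ adj x y &
    forall z, adj x z -> adj y z -> ~~ adj v z].
  move=> vx; have nxv := nv x vx; have A0 := AB0 _ (nv _ vyA) yAA.
  have B0 := fun h => AB0 _ (nv _ vyB) h yBB; have X0 := AB0 _ nxv.
  have [xA|xA] := boolP (x \in A).
  - exists yB; split=> //.
    + by apply: contraPneq xA => <-.
    + by apply/negP => /(tri _ _ vx vyB) /orP[] /andP[]; auto.
    + move=> z xz yz; apply/negP => vz; have Z0 := AB0 _ (nv _ vz).
      by case/orP: (tri _ _ vx vz xz) => /andP[? ?];
        case/orP: (tri _ _ vyB vz yz) => /andP[? ?]; auto.
  - exists yA; split=> //.
    + by apply: contraNneq xA => <-.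
    + by apply/negP => /(tri _ _ vx vyA) /orP[] /andP[]; rewrite ?(negPf xA); auto.
    + move=> z xz yz; apply/negP => vz; have Z0 := AB0 _ (nv _ vz).
      case/orP: (tri _ _ vx vz xz) => /andP[xC zC]; first by rewrite xC in xA.
      by case/orP: (tri _ _ vyA vz yz) => /andP[? ?]; auto.
have cvN : #|v |: N| = #|N|.+1 by rewrite cardsU1 inE adj_irr.
have cM : #|G|.-1 = #|N| + #|~: (v |: N)|.
  by rewrite -(cardsC (v |: N)) cvN addSn.
rewrite cM; apply: isolating_triangles => x; rewrite !inE.
- move=> vx; have [y [nyx vy xy out]] := far x vx.
  have [|u [w [uw xu xw yu yw]]] := sat x y _ xy; first by rewrite eq_sym.
  exists [set x; u; w]; first exact/clique3P.
  have [nu nw] := (out u xu yu, out w xw yw).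
  apply/setP => z; rewrite !inE -orbA.
  have [->|nzx] := eqVneq z x; first by rewrite vx.
  have [->|nzu] := eqVneq z u; first by rewrite (negPf nu).
  by have [->|nzw] := eqVneq z w; first by rewrite (negPf nw).
- rewrite negb_or => /andP[nxv vx].
  have [|u [w [uw vu vw xu xw]]] := sat v x _ vx; first by rewrite eq_sym.
  exists [set x; u; w]; first exact/clique3P.
  apply/setP => z; rewrite !inE -orbA.
  have [->|nzx] := eqVneq z x; first by rewrite vx.
  have [->|nzu] := eqVneq z u; first by rewrite vu.
  by have [->|nzw] := eqVneq z w; [rewrite vw | rewrite andbF].
Qed.

(** * Books *)

Definition book_on (G : sgraph) (a b : G) : Prop :=
  a != b /\
  forall x y, adj x y = (x != y) && ((x \in [set a; b]) || (y \in [set a; b])).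

(** Both a and b lie in the unique triangle vab at v, so both are dominating, and
    an edge disjoint from ab would complete a K_4. *)
Lemma triangles_at1_book (G : sgraph) (v : G) :
  K4_saturated G -> #|triangles_at v| = 1 -> exists a b : G, book_on a b.
Proof.
move=> sat /eqP/cards1P[S eS].
have := set11 S; rewrite -eS inE => /andP[S3 vS].
have [a [b [eSab va vb ab]]] := clique3_mem S3 vS.
have dom c : c \in S -> v != c -> dominating c.
  move=> cS nvc; apply: common_triangle_vertex_dominating sat nvc _ _.
    by rewrite eS; apply/set0Pn; exists S; rewrite set11.
  by move=> S'; rewrite eS => /set1P->.
have doma : dominating a by apply: dom; rewrite ?adj_neq // eSab !inE eqxx orbT.
have domb : dominating b by apply: dom; rewrite ?adj_neq // eSab !inE eqxx orbT.
exists a, b; split=> [|x y]; first exact: adj_neq.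
have [->|nxy] := eqVneq x y; first by rewrite adj_irr.
rewrite eq_sym in nxy.
have [/set2P[] ex|xab] := boolP (x \in _); rewrite /=.
- by rewrite ex doma // -ex.
- by rewrite ex domb // -ex.
rewrite eq_sym in nxy.
have [/set2P[] ey|yab] := boolP (y \in _).
- by rewrite ey adj_sym doma // -ey.
- by rewrite ey adj_sym domb // -ey.
apply/negP => xy; case: sat => k4 _.
move: xab yab; rewrite !inE !negb_or => /andP[xa xb] /andP[ya yb].
have /clique3P k := And3 (doma x xa) (doma y ya) xy.
have [z] := k4 _ k b; rewrite !inE -orbA => /or3P[] /eqP->.
- by rewrite adj_sym ab.
- by rewrite domb.
- by rewrite domb.
Qed.

Lemma book_saturated (G : sgraph) (a b : G) : book_on a b -> K4_saturated G.
Proof.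
case=> nab adjE; split=> [S S3 x|x y nxy].
  apply/exists_inP; rewrite -negb_forall_in; apply/negP => /forall_inP xS.
  have /cliquesP[c4 k4] := clique_extend S3 xS.
  (* Four vertices cannot be covered by a and b even after one is dropped, so
     two of them lie outside the spine and are not adjacent. *)
  have /subsetPn[y yQ yab] : ~~ (x |: S \subset [set a; b]).
    by apply/negP => /subset_leq_card; rewrite cards2 nab c4.
  have /subsetPn[z /setD1P[nzy zQ] zab] : ~~ ((x |: S) :\ y \subset [set a; b]).
    apply/negP => /subset_leq_card.
    by move: (cardsD1 y (x |: S)); rewrite yQ c4 cards2 nab; lia.
  by have := k4 z y zQ yQ nzy; rewrite adjE (negPf yab) (negPf zab) andbF.
rewrite adjE nxy /= negb_or !inE !negb_or => /andP[/andP[xa xb] /andP[ya yb]].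
by exists a, b; split; rewrite adjE ?nab ?xa ?xb ?ya ?yb !inE eqxx ?orbT.
Qed.

(** The triangles are a, b and a third vertex: a triangle missing a or b would be
    completed by it to a K_4. *)
Lemma card_triangles_book (G : sgraph) (a b : G) :
  book_on a b -> #|cliques 3 G| = #|G| - 2.
Proof.
move=> bk; have [nab adjE] := bk.
have <- : #|~: [set a; b]| = #|G| - 2 by rewrite cardsCs setCK cards2 nab.
have <- : [set [set a; b; x] | x in ~: [set a; b]] = cliques 3 G.
  apply/setP => S; apply/imsetP/idP => [[x xab ->]|S3].
    move: xab; rewrite in_setC in_set2 negb_or => /andP[xa xb].
    apply/clique3P; rewrite !adjE nab ![_ == x]eq_sym xa xb !inE !eqxx.
    by rewrite !orbT.
  have [k4 _] := book_saturated bk.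
  have inS c : c \in [set a; b] -> c \in S.
    move=> cab; apply: contraT => ncS; have [y yS] := k4 S S3 c.
    rewrite adjE cab andbT negbK => /eqP ecy.
    by rewrite ecy yS in ncS.
  have aS : a \in S by apply: inS; rewrite set21.
  have [p [q [eS ap aq pq]]] := clique3_mem S3 aS.
  have bS : b \in S by apply: inS; rewrite set22.
  move: bS; rewrite eS !inE eq_sym (negPf nab) /= => /orP[] /eqP e; subst.
    by exists q => //; rewrite !inE negb_or ![q == _]eq_sym !adj_neq.
  exists p; first by rewrite !inE negb_or (adj_neq pq) eq_sym (adj_neq ap).
  by rewrite setUAC.
rewrite card_in_imset // => x y; rewrite !inE !negb_or => /andP[xa xb] _ e.
have: x \in [set a; b; y] by rewrite -e !inE eqxx orbT.
by rewrite !inE (negPf xa) (negPf xb) /= => /eqP.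
Qed.

(** The isomorphism sends the two vertices of K_2 to a and b and enumerates the
    other vertices by the independent set. *)
Lemma book_gisoP (n : nat) (G : sgraph) : #|G| = n ->
  (exists a b : G, book_on a b) <->
  giso G (join_graph (complete_graph 2) (edgeless_graph (n - 2))).
Proof.
move=> cG; split=> [[a [b [nab adjE]]]|/gisoP[f [[g fK gK] mf]]].
- have cR : n - 2 = #|~: [set a; b]| by rewrite cardsCs setCK cards2 nab cG.
  pose h (u : 'I_2 + 'I_(n - 2)) : G :=
    match u with
    | inl i => if i == ord0 then a else b
    | inr j => enum_val (cast_ord cR j)
    end.
  have hl i : h (inl i) \in [set a; b] by rewrite /h; case: ifP; rewrite !inE eqxx ?orbT.
  have hr j : h (inr j) \notin [set a; b].
    by have := enum_valP (cast_ord cR j); rewrite inE.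
  have hI : injective h.
    move=> [i|j] [i'|j'] e.
    + congr inl; apply/val_inj; move: e nab => /=.
      by case: i i' => [[|[|i]] //= ?] [[|[|i']] //= ?] // ->; rewrite eqxx.
    + by have := hr j'; rewrite -e hl.
    + by have := hr j; rewrite e hl.
    + by congr inr; apply: cast_ord_inj (enum_val_inj e).
  have [|k hK kK] := inj_card_bij hI.
    rewrite card_sum !card_ord cG.
    by have := max_card (mem [set a; b]); rewrite cards2 nab cG; lia.
  apply/gisoP; exists k; split; first by exists h.
  move=> x y; rewrite -[x in RHS]kK -[y in RHS]kK adjE (inj_eq hI).
  case: (k x) (k y) => [i|j] [i'|j']; rewrite ?hl ?(negPf (hr _)) ?orbT ?andbT ?andbF //=.
- exists (g (inl ord0)), (g (inl ord_max)); split.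
    by rewrite (can_eq gK).
  move=> x y; rewrite -mf -(can_eq fK x y) !inE -!(can2_eq fK gK).
  by case: (f x) (f y) => [[[|[|i]] // ?]|j] [[[|[|i']] // ?]|j'] //=; rewrite andbF.
Qed.

(** * The lower bound and the extremal graph *)

Lemma book_or_many_triangles (G : sgraph) :
  K4_saturated G -> 2 < #|G| ->
  (exists a b : G, book_on a b) \/ #|G|.-1 <= #|cliques 3 G|.
Proof.
move=> sat G3; have t1 (v : G) := triangles_at_gt0 v sat G3.
have [/existsP[v /eqP tv]|no1] := boolP [exists v : G, #|triangles_at v| == 1].
  by left; apply: triangles_at1_book sat tv.
right; have t2 (v : G) : 1 < #|triangles_at v|.
  by move: no1; rewrite negb_exists => /forallP/(_ v); have := t1 v; lia.
have [/existsP[v]|no2] := boolP [exists v : G, #|triangles_at v| == 2]; last first.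
  suff: \sum_(v : G) 3 <= \sum_(v : G) #|triangles_at v|.
    by rewrite sum_triangles_at sum_nat_const cardT -cardE; lia.
  apply: leq_sum => v _; move: no2; rewrite negb_exists => /forallP/(_ v).
  by have := t2 v; lia.
case/cards2P => A [B [nAB eT]].
have inT C : C \in [set A; B] -> v \in C.
  by rewrite -eT inE => /andP[].
have [vA vB] : v \in A /\ v \in B by split; apply: inT; rewrite ?set21 ?set22.
have [AB|] := eqVneq (A :&: B) [set v].
  exact: almost_disjoint_triangles sat eT AB.
rewrite eqEsubset sub1set inE vA vB !andbT => /subsetPn[b].
rewrite !inE => /andP[bA bB] nbv; apply: (@dominating_triangles _ b) => //.
apply: (@common_triangle_vertex_dominating _ v) => //.
- by rewrite eq_sym.
- by rewrite eT; apply/set0Pn; exists A; rewrite set21.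
- by move=> S; rewrite eT => /set2P[]->.
Qed.

Theorem theorem1p3 (n : nat) (hn : 7 <= n) :
  is_sat n (complete_graph 3) (complete_graph 4) (n - 2) /\
  (forall G : sgraph, #|G| = n ->
     (saturated (complete_graph 4) G /\ #|copies (complete_graph 3) G| = n - 2
      <-> giso G (join_graph (complete_graph 2) (edgeless_graph (n - 2))))).
Proof.
have book (G : sgraph) : #|G| = n -> (exists a b : G, book_on a b) ->
    saturated (complete_graph 4) G /\ #|copies (complete_graph 3) G| = n - 2.
  move=> cG [a [b bk]]; rewrite card_copies_complete (card_triangles_book bk) cG.
  by split=> //; apply/saturated_K4P/(book_saturated bk).
have lower (G : sgraph) : #|G| = n -> saturated (complete_graph 4) G ->
    (exists a b : G, book_on a b) \/ n.-1 <= #|copies (complete_graph 3) G|.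
  move=> cG /saturated_K4P sat; rewrite card_copies_complete -cG.
  by apply: book_or_many_triangles => //; rewrite cG; lia.
split; last first.
  move=> G cG; rewrite -book_gisoP //; split; last exact: book.
  by case=> sat cT; have [|] := lower G cG sat; last by rewrite cT; lia.
split=> [|G cG sat].
  pose J := join_graph (complete_graph 2) (edgeless_graph (n - 2)).
  have cJ : #|J| = n by rewrite card_sum !card_ord; lia.
  have /(book J cJ)[sJ tJ] : exists a b : J, book_on a b.
    by apply/(book_gisoP cJ)/gisoP; exists id; split=> //; exists id.
  by exists J.
by have [/(book G cG)[_ ->]|] := lower G cG sat; last lia.
Qed.
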